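(* Let $x\in\mathbb{R}^n$. Then the following expressions are equivalent: (i) $\|x\|_0\leq r$; (ii) there exists $w\in\{w\in\mathbb{R}^n : 0\leq w_i\leq 1,\ i=1,\dots,n;\ \sum_{i=1}^n w_i=n-r\}$ such that $x_iw_i=0$ for $i=1,\dots,n$.
   Context: $r$ is a given number, on which no further condition is stated. For $x\in\mathbb{R}^n$, $\|x\|_0$ denotes the $\ell_0$ pseudo-norm, that is, the number of nonzero elements of $x$; $x_i$ and $w_i$ denote the $i$-th entries of $x$ and $w$.
   Formalization: The formal statement adds the assumption r ≤ n; for r > n the claim is false for every x, since (i) always holds while no w with nonnegative entries can have the negative sum n − r (e.g. n = 1, r = 2, x = 0). *)

(* Defs.v *)
From mathcomp Require Import all_boot all_order all_algebra.
From mathcomp Require Import reals.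

Set Implicit Arguments.
Unset Strict Implicit.
Unset Printing Implicit Defensive.

Import Order.TTheory GRing.Theory Num.Theory.
Local Open Scope ring_scope.

Definition l0norm (R : realType) (n : nat) (x : 'cV[R]_n) : nat :=
  #|[set i : 'I_n | x i 0 != 0]|.

(* Main.v *)
Require Import Defs.
From mathcomp Require Import all_boot all_order all_algebra.
From mathcomp Require Import reals.

Set Implicit Arguments.
Unset Strict Implicit.
Unset Printing Implicit Defensive.

Import Order.TTheory GRing.Theory Num.Theory.
Local Open Scope ring_scope.

(** The indicator vector of the zero set of [x] dominates every admissible [w]
    entrywise, and its entries add up to [n - l0norm x]; conversely, rescaling
    it by [(n - r) / (n - l0norm x)] gives an admissible [w]. *)

Lemma sum_zero_indicator (R : realType) (n : nat) (x : 'cV[R]_n) :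
  \sum_(i < n) (x i 0 == 0)%:R = n%:R - (l0norm x)%:R :> R.
Proof.
(* Cleared of subtraction, this is an identity in [nat]: each index counts once, as a zero or a
   nonzero entry. *)
rewrite -natr_sum; apply/eqP; rewrite eq_sym subr_eq -natrD eqr_nat eq_sym.
have -> : l0norm x = (\sum_(i < n) (x i 0 != 0)%R)%N.
  by rewrite /l0norm -sum1_card big_mkcond; apply: eq_bigr => i _; rewrite inE.
rewrite -big_split /=; apply/eqP; rewrite -[RHS]card_ord -sum1_card.
by apply: eq_bigr => i _; case: (x i 0 == 0).
Qed.

(** If [r > n], (i) always holds while no nonnegative [w] has the negative sum [n - r]; [hr]
    excludes this case. *)
Theorem corollary1 (R : realType) (n : nat) (r : R) (hr : r <= n%:R)
    (x : 'cV[R]_n) :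
  (l0norm x)%:R <= r <->
  exists w : 'cV[R]_n,
    [/\ forall i : 'I_n, 0 <= w i 0 <= 1,
        \sum_(i < n) w i 0 = n%:R - r
      & forall i : 'I_n, x i 0 * w i 0 = 0].
Proof.
split=> [le_xr | [w [w01 sum_w xw0]]]; last first.
  (* Rewritten as [n - r <= n - l0norm x], the goal compares two sums term by term: [w i 0] vanishes
     where [x i 0] does not, and is at most 1 elsewhere. *)
  rewrite -(lerD2l (- n%:R)) -lerN2 !opprD !opprK -sum_w -sum_zero_indicator.
  apply: ler_sum => i _; have /andP[_ w_le1] := w01 i.
  by have /eqP := xw0 i; rewrite mulf_eq0; case: eqP => //= _ /eqP ->.
set z : R := n%:R - (l0norm x)%:R.
have le_nr_z : n%:R - r <= z by rewrite lerD2l lerN2.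
have nr_ge0 : 0 <= n%:R - r by rewrite subr_ge0.
have z_ge0 : 0 <= z := le_trans nr_ge0 le_nr_z.
(* When [z = 0], [c] is the junk value [0], which is right since then [n = r]. *)
pose c := (n%:R - r) / z.
have cz : c * z = n%:R - r.
  have [z0|z_neq0] := eqVneq z 0; last by rewrite /c divfK.
  by apply/eqP; rewrite z0 mulr0 eq_le nr_ge0 -z0 le_nr_z.
have c_ge0 : 0 <= c by rewrite divr_ge0.
have c_le1 : c <= 1.
  have [z0|z_neq0] := eqVneq z 0; first by rewrite /c z0 invr0 mulr0 ler01.
  by rewrite ler_pdivrMr ?mul1r // lt_def z_neq0.
exists (\col_i (c * (x i 0 == 0)%:R)); split=> [i||i].
- by rewrite mxE; case: eqP => _; rewrite ?mulr1 ?mulr0 ?lexx ?ler01 ?c_ge0.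
- under eq_bigr do rewrite mxE.
  by rewrite -mulr_sumr sum_zero_indicator.
- by rewrite mxE; case: eqP => [->|_]; rewrite ?mul0r ?mulr0.
Qed.
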